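(* Let $M$ be a finitely generated torsion-free commutative binoid and $K$ an algebraically closed field. The following statements are equivalent: (1) $K\text{-}\mathrm{spec}\,M$ is connected. (2) For any two cancellative $K$-components $X$ and $Y$ of $M$ there is a sequence $X(1),\ldots,X(n)$ of cancellative $K$-components with $X(1)=X$ and $X(n)=Y$ such that $X(i)\cap X(i+1)$ contains a $K$-point for every $i\in\{1,\ldots,n-1\}$. (3) For any two cancellative $K$-components $X$ and $Y$ of $M$ there is a sequence $X(1),\ldots,X(n)$ of cancellative $K$-components with $X(1)=X$ and $X(n)=Y$ such that $X(i)\cap X(i+1)$ contains a characteristic point for every $i\in\{1,\ldots,n-1\}$.
   Context: A (commutative, additively written) binoid is a commutative monoid $(M,+,0)$ with an absorbing element $\infty$ ($a+\infty=\infty$ for all $a$). Homomorphisms of binoids are monoid homomorphisms with $\infty\mapsto\infty$. $M$ is finitely generated if there are finitely many elements such that every element $\ne\infty$ is a finite sum of them. $M$ is torsion-free if $na=nb$ with $n\ge1$, $a,b\in M$ implies $a=b$. An ideal of $M$ is a subset $I$ with $\infty\in I$ and $I+M\subseteq I$; a prime ideal is an ideal $P\neq M$ such that $M\setminus P$ is a submonoid; $\mathrm{spec}\,M$ is the set of prime ideals. $M/P$ is the binoid obtained from $M$ by identifying all elements of $P$ with $\infty$ (and nothing else). For $P$ prime, $M/P$ is integral (the sum of elements $\neq\infty$ is $\ne\infty$), and $(M/P)_{\mathrm{can}}$ denotes the quotient of $M/P$ by the congruence: $a\sim b$ iff $a+s=b+s$ for some $s\in M/P$, $s\neq\infty$.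 For a field $K$, viewed as a binoid $(K,\cdot,1,0)$ with identity $1$ and absorbing element $0$, $K\text{-}\mathrm{spec}\,M$ is the set of binoid homomorphisms $\varphi:M\to K$ ($K$-points). Let $K[M]$ be the $K$-algebra with basis $T^a$, $a\in M\setminus\{\infty\}$, and $T^aT^b=T^{a+b}$ if $a+b\ne\infty$, $T^aT^b=0$ otherwise. Every $K$-point $\varphi$ extends to the $K$-algebra homomorphism $\tilde\varphi:K[M]\to K$, $\sum r_aT^a\mapsto\sum r_a\varphi(a)$. The (Zariski) topology on $K\text{-}\mathrm{spec}\,M$ has as closed sets $\{\varphi\mid\tilde\varphi(F)=0\text{ for all }F\in S\}$, $S\subseteq K[M]$. A nonempty topological space is said to be connected if it is not the union of two disjoint nonempty open sets. For $P\in\mathrm{spec}\,M$ the canonical surjection $M\to (M/P)_{\mathrm{can}}$ identifies $K\text{-}\mathrm{spec}\,(M/P)_{\mathrm{can}}$ with a closed subset of $K\text{-}\mathrm{spec}\,M$, called a cancellative $K$-part; the cancellative $K$-components of $M$ are the cancellative $K$-parts that are maximal with respect to inclusion. A characteristic point is a $K$-point with values in $\{0,1\}$, i.e. one of the form $\alpha_P$ with $\alpha_P(a)=0$ for $a\in P$ and $\alpha_P(a)=1$ for $a\notin P$, for some $P\in\mathrm{spec}\,M$. *)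

(* Defs.v *)
From HB Require Import structures.
From mathcomp Require Import all_boot all_order all_algebra finmap.
From mathcomp Require Import generic_quotient.
From mathcomp Require Import mathcomp_extra boolp classical_sets functions.
From mathcomp Require Import topology.

Set Implicit Arguments.
Unset Strict Implicit.
Unset Printing Implicit Defensive.

Import GRing.Theory.

Local Open Scope classical_set_scope.
Local Open Scope quotient_scope.
Local Open Scope ring_scope.

HB.mixin Record Nmodule_isBinoid M of GRing.Nmodule M := {
  infty : M;
  addi : forall a : M, a + infty = infty
}.

#[short(type="binoidType")]
HB.structure Definition Binoid := { M of GRing.Nmodule M & Nmodule_isBinoid M }.

Arguments infty {s}.

HB.mixin Record Binoid_isIntegral M of Binoid M := {
  zero_neq_infty : (0 : M) != infty;
  integralD : forall a b : M, a != infty -> b != infty -> a + b != infty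
}.

#[short(type="integralBinoidType")]
HB.structure Definition IntegralBinoid := { M of Binoid M & Binoid_isIntegral M }.

Lemma iadd (M : binoidType) (a : M) : infty + a = infty.
Proof. by rewrite addrC addi. Qed.

Definition finitely_generated (M : binoidType) : Prop :=
  exists s : seq M, forall a : M, a != infty ->
    exists2 t : seq M, {subset t <= s} & a = \sum_(x <- t) x.

Definition torsion_free (M : binoidType) : Prop :=
  forall (n : nat) (a b : M), (0 < n)%N -> a *+ n = b *+ n -> a = b.

Record binoid_hom (M N : binoidType) := BinoidHom {
  binoid_hom_fun :> M -> N;
  binoid_hom0 : binoid_hom_fun 0 = 0;
  binoid_homD : {morph binoid_hom_fun : a b / a + b};
  binoid_homi : binoid_hom_fun infty = infty
}.

Section CompHom.
Context {M N L : binoidType} (g : binoid_hom N L) (f : binoid_hom M N).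

Fact comp_hom0 : (g \o f) 0 = 0.
Proof. by rewrite /= !binoid_hom0. Qed.

Fact comp_homD : {morph g \o f : a b / a + b}.
Proof. by move=> a b; rewrite /= !binoid_homD. Qed.

Fact comp_homi : (g \o f) infty = infty.
Proof. by rewrite /= !binoid_homi. Qed.

Definition comp_hom : binoid_hom M L := BinoidHom comp_hom0 comp_homD comp_homi.

End CompHom.

Section Ideals.
Context {M : binoidType}.

Definition is_ideal (I : set M) : Prop :=
  I infty /\ (forall a b : M, I a -> I (a + b)).

Definition is_submonoid (S : set M) : Prop :=
  S 0 /\ (forall a b : M, S a -> S b -> S (a + b)).

Definition is_prime (P : set M) : Prop :=
  [/\ is_ideal P, P <> setT & is_submonoid (~` P)].

End Ideals.

Record spec (M : binoidType) := Spec {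
  prime_ideal :> M -> Prop;
  primeP : is_prime prime_ideal
}.

Record congruence (M : binoidType) := Congruence {
  cong_rel :> rel M;
  cong_refl : reflexive cong_rel;
  cong_sym : symmetric cong_rel;
  cong_trans : transitive cong_rel;
  congD : forall c a b : M, cong_rel a b -> cong_rel (a + c) (b + c)
}.

Definition cong_equiv (M : binoidType) (R : congruence M) : equiv_rel M :=
  EquivRel R (cong_refl R) (cong_sym R) (@cong_trans M R).

Definition bquot (M : binoidType) (R : congruence M) : Type :=
  {eq_quot cong_equiv R}.

Section BinoidQuotient.
Context {M : binoidType} (R : congruence M).

HB.instance Definition _ := Choice.on (bquot R).

Definition bproj (a : M) : bquot R := \pi_({eq_quot cong_equiv R}) a.
Definition brepr (x : bquot R) : M :=
  repr (x : {eq_quot cong_equiv R}).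

Lemma breprK (x : bquot R) : bproj (brepr x) = x.
Proof. exact: reprK. Qed.

Lemma bprojP (a b : M) : bproj a = bproj b <-> R a b.
Proof.
rewrite /bproj; split=> [/eqP|h]; first by rewrite eqmodE.
by apply/eqP; rewrite eqmodE.
Qed.

Lemma brepr_rel (a : M) : R (brepr (bproj a)) a.
Proof. by apply/bprojP; rewrite breprK. Qed.

Definition bquot_add (x y : bquot R) : bquot R := bproj (brepr x + brepr y).

Lemma bprojD (a b : M) : bquot_add (bproj a) (bproj b) = bproj (a + b).
Proof.
apply/bprojP; apply: (@cong_trans _ R (a + brepr (bproj b))).
  exact: congD (brepr_rel a).
by rewrite ![a + _]addrC; exact: congD (brepr_rel b).
Qed.

Fact bquot_addA : associative bquot_add.
Proof.
move=> x y z; rewrite -(breprK x) -(breprK y) -(breprK z).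
by rewrite !bprojD addrA.
Qed.

Fact bquot_addC : commutative bquot_add.
Proof. by move=> x y; rewrite /bquot_add addrC. Qed.

Fact bquot_add0 : left_id (bproj 0) bquot_add.
Proof. by move=> x; rewrite -(breprK x) bprojD add0r. Qed.

HB.instance Definition _ :=
  GRing.isNmodule.Build (bquot R) bquot_addA bquot_addC bquot_add0.

Fact bquot_addi (x : bquot R) : x + bproj infty = bproj infty.
Proof. by rewrite -(breprK x) [LHS]bprojD addi. Qed.

HB.instance Definition _ := Nmodule_isBinoid.Build (bquot R) bquot_addi.

Definition bproj_hom : binoid_hom M (bquot R) :=
  BinoidHom (erefl : bproj 0 = 0) (fun a b => esym (bprojD a b))
            (erefl : bproj infty = infty).

End BinoidQuotient.

(** The binoid [M / P]. *)

Section ReesQuotient.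
Context {M : binoidType} (P : spec M).

Definition rees_rel : rel M :=
  fun a b => (a == b) || (`[< P a >] && `[< P b >]).

Fact rees_refl : reflexive rees_rel.
Proof. by move=> a; rewrite /rees_rel eqxx. Qed.

Fact rees_sym : symmetric rees_rel.
Proof. by move=> a b; rewrite /rees_rel eq_sym andbC. Qed.

Fact rees_trans : transitive rees_rel.
Proof.
move=> b a c; rewrite /rees_rel => /orP[/eqP-> //|/andP[Pa Pb]].
by move=> /orP[/eqP<-|/andP[_ Pc]]; rewrite Pa ?Pb ?Pc orbT.
Qed.

Fact rees_congD (c a b : M) : rees_rel a b -> rees_rel (a + c) (b + c).
Proof.
have [[_ PD] _ _] := primeP P.
move=> /orP[/eqP->|/andP[/asboolP Pa /asboolP Pb]]; first exact: rees_refl.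
by apply/orP; right; apply/andP; split; apply/asboolP; exact: PD.
Qed.

Definition rees_cong : congruence M :=
  Congruence rees_refl rees_sym rees_trans rees_congD.

Definition rees : Type := bquot rees_cong.

HB.instance Definition _ := Binoid.on rees.

Lemma bproj_rees_infty (a : M) : (bproj rees_cong a = infty) <-> P a.
Proof.
have [[Pi _] _ _] := primeP P.
split=> [/bprojP/orP[/eqP-> //|/andP[/asboolP //]]|Pa].
by apply/bprojP/orP; right; apply/andP; split; apply/asboolP.
Qed.

Fact rees_zero_neq_infty : (0 : rees) != infty.
Proof. by have [_ _ [P0 _]] := primeP P; apply/eqP => /bproj_rees_infty. Qed.

Fact rees_integralD (x y : rees) :
  x != infty -> y != infty -> x + y != infty.
Proof.
have [_ _ [_ PD]] := primeP P.
rewrite -(breprK x) -(breprK y) => /eqP xi /eqP yi; apply/eqP.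
rewrite -(binoid_homD (bproj_hom rees_cong)) /= => /bproj_rees_infty.
by apply: PD => /bproj_rees_infty.
Qed.

HB.instance Definition _ :=
  Binoid_isIntegral.Build rees rees_zero_neq_infty rees_integralD.

End ReesQuotient.

(** Integrality of [N] is what makes [can_rel] transitive (and [0 != infty] what
   makes it reflexive). *)

Section CanQuotient.
Context (N : integralBinoidType).

Definition can_rel : rel N :=
  fun a b => `[< exists2 s : N, s != infty & a + s = b + s >].

Fact can_refl : reflexive can_rel.
Proof. by move=> a; apply/asboolP; exists 0; rewrite ?zero_neq_infty. Qed.

Fact can_sym : symmetric can_rel.
Proof. by move=> a b; apply/asboolP/asboolP => -[s s0 e]; exists s. Qed.

Fact can_trans : transitive can_rel.
Proof.
move=> b a c /asboolP[s s0 e] /asboolP[t t0 f]; apply/asboolP.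
exists (s + t); first exact: integralD.
by rewrite addrA e addrAC f -!addrA (addrC t).
Qed.

Fact can_congD (c a b : N) : can_rel a b -> can_rel (a + c) (b + c).
Proof.
move=> /asboolP[s s0 e]; apply/asboolP; exists s => //.
by rewrite addrAC e addrAC.
Qed.

Definition can_cong : congruence N :=
  Congruence can_refl can_sym can_trans can_congD.

Definition can : Type := bquot can_cong.

HB.instance Definition _ := Binoid.on can.

End CanQuotient.

Definition can_surjection (M : binoidType) (P : spec M) :
    binoid_hom M (can (rees P)) :=
  comp_hom (bproj_hom (can_cong (rees P))) (bproj_hom (rees_cong P)).

(** The binoid algebra [K[M]].  An element is its family of coefficients, a
   finitely supported function on [M] vanishing at [infty].  If [0 = infty] in
   [M] then [K[M]] is the zero ring, so it is only a [comPzRingType] and an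
   [lmodType], not an [algType], which the library restricts to nonzero rings;
   the remaining algebra axiom is [binalg_scaleAl].  [monomial a] is [T^a], with
   [T^infty = 0]. *)

Section BinoidAlgebra.
Context (M : binoidType) (K : fieldType).

Record binalg := BinAlg {
  coefs : {fsfun M -> K with 0};
  coefs_infty : coefs infty == 0
}.

HB.instance Definition _ := [isSub for coefs].
HB.instance Definition _ := [Choice of binalg by <:].

Implicit Types (F G H : binalg) (a b c : M) (h : M -> K).

Lemma binalgP F G : coefs F =1 coefs G -> F = G.
Proof. by move=> e; apply: val_inj; apply/fsfunP. Qed.

Lemma coefsi F : coefs F infty = 0.
Proof. by apply/eqP; case: F. Qed.

Definition mkcoefs (A : {fset M}) h : {fsfun M -> K with 0} :=
  [fsfun a in A => if a == infty then 0 else h a | 0].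

Fact mkcoefs_infty A h : mkcoefs A h infty == 0.
Proof. by rewrite fsfunE eqxx if_same. Qed.

Definition mkbinalg A h : binalg := BinAlg (mkcoefs_infty A h).

Lemma mkbinalgE (A : {fset M}) h a :
  (forall b, b \notin A -> h b = 0) -> h infty = 0 ->
  coefs (mkbinalg A h) a = h a.
Proof.
move=> hA hi; rewrite fsfunE; case: eqP => [->|_]; first by rewrite hi if_same.
by case: ifPn => // /hA ->.
Qed.

(* the linear extension of [T^a |-> h a] *)
Definition lext h F : K := \sum_(a <- finsupp (coefs F)) coefs F a * h a.

Lemma lext_supp (A : {fset M}) h F : (finsupp (coefs F) `<=` A)%fset ->
  lext h F = \sum_(a <- A) coefs F a * h a.
Proof.
move=> sFA; apply: big_fset_incl => // a _ /fsfun_dflt ->.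
by rewrite mul0r.
Qed.

Lemma lext_coef F c : c != infty -> coefs F c = lext (fun a => (a == c)%:R) F.
Proof.
move=> ci; rewrite (@lext_supp (c |` finsupp (coefs F))%fset) ?fsubsetU1 //.
rewrite (big_fsetD1 c) ?fset1U1 //= eqxx mulr1 big_seq big1 ?addr0 // => a.
by rewrite !inE => /andP[/negPf -> _]; rewrite mulr0.
Qed.

Lemma eq_lext h h' F : h =1 h' -> lext h F = lext h' F.
Proof. by move=> e; apply: eq_bigr => a _; rewrite e. Qed.

Definition binalg_zero : binalg := mkbinalg fset0 (fun=> 0).

Definition binalg_add F G : binalg :=
  mkbinalg (finsupp (coefs F) `|` finsupp (coefs G))%fset
           (fun a => coefs F a + coefs G a).

Definition binalg_scale (r : K) F : binalg :=
  mkbinalg (finsupp (coefs F)) (fun a => r * coefs F a).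

Definition binalg_opp F : binalg := binalg_scale (-1) F.

Lemma coefs0 a : coefs binalg_zero a = 0.
Proof. by rewrite mkbinalgE. Qed.

Lemma coefsD F G a : coefs (binalg_add F G) a = coefs F a + coefs G a.
Proof.
rewrite mkbinalgE ?coefsi ?addr0 // => b.
by rewrite inE negb_or => /andP[/fsfun_dflt -> /fsfun_dflt ->]; rewrite addr0.
Qed.

Lemma coefsZ r F a : coefs (binalg_scale r F) a = r * coefs F a.
Proof.
by rewrite mkbinalgE ?coefsi ?mulr0 // => b /fsfun_dflt ->; rewrite mulr0.
Qed.

Fact binalg_addA : associative binalg_add.
Proof. by move=> F G H; apply: binalgP => a; rewrite !coefsD addrA. Qed.

Fact binalg_addC : commutative binalg_add.
Proof. by move=> F G; apply: binalgP => a; rewrite !coefsD addrC. Qed.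

Fact binalg_add0 : left_id binalg_zero binalg_add.
Proof. by move=> F; apply: binalgP => a; rewrite coefsD coefs0 add0r. Qed.

Fact binalg_addN : left_inverse binalg_zero binalg_opp binalg_add.
Proof.
by move=> F; apply: binalgP => a; rewrite coefsD coefsZ coefs0 mulN1r addNr.
Qed.

HB.instance Definition _ := GRing.isZmodule.Build binalg
  binalg_addA binalg_addC binalg_add0 binalg_addN.

Lemma lextD h F G : lext h (F + G) = lext h F + lext h G.
Proof.
set A := (finsupp (coefs F) `|` finsupp (coefs G))%fset.
rewrite (@lext_supp A h F) ?fsubsetUl // (@lext_supp A h G) ?fsubsetUr //.
rewrite (@lext_supp A); last first.
  apply/fsubsetP => a; rewrite !mem_finsupp inE !mem_finsupp coefsD.
  by apply: contraR; rewrite negb_or !negbK => /andP[/eqP-> /eqP->]; rewrite addr0.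
by rewrite -big_split /=; apply: eq_bigr => a _; rewrite coefsD mulrDl.
Qed.

Lemma lextZ h r F : lext h (binalg_scale r F) = r * lext h F.
Proof.
rewrite (@lext_supp (finsupp (coefs F))) /lext ?mulr_sumr; last first.
  apply/fsubsetP => a; rewrite !mem_finsupp coefsZ.
  by apply: contraNneq => ->; rewrite mulr0.
by apply: eq_bigr => a _; rewrite coefsZ mulrA.
Qed.

Definition monomial a : binalg := mkbinalg [fset a]%fset (fun=> 1).

Lemma lext_monomial h a : h infty = 0 -> lext h (monomial a) = h a.
Proof.
move=> hi; rewrite (@lext_supp [fset a]%fset) ?big_seq_fset1 ?fsfunE ?inE ?eqxx.
  by case: eqP => [->|_]; rewrite ?mul0r ?hi ?mul1r.
by apply/fsubsetP => b; rewrite mem_finsupp fsfunE; case: ifP => //; rewrite eqxx.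
Qed.

Definition binalg_mul F G : binalg :=
  mkbinalg [fset (a + b)%R | a in finsupp (coefs F), b in finsupp (coefs G)]%fset
    (fun c => \sum_(a <- finsupp (coefs F)) \sum_(b <- finsupp (coefs G) | a + b == c)
       coefs F a * coefs G b).

Lemma lextM h F G : h infty = 0 ->
  lext h (binalg_mul F G) = lext (fun a => lext (fun b => h (a + b)) G) F.
Proof.
move=> hi; set A := [fset (a + b)%R | a in finsupp (coefs F), b in finsupp (coefs G)]%fset.
have sA : (finsupp (coefs (binalg_mul F G)) `<=` A)%fset.
  apply/fsubsetP => c; rewrite mem_finsupp fsfunE -/A.
  by case: ifP => //; rewrite eqxx.
rewrite (lext_supp h sA) /lext.
transitivity (\sum_(c <- A) \sum_(a <- finsupp (coefs F))
    \sum_(b <- finsupp (coefs G) | a + b == c) coefs F a * coefs G b * h c).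
  rewrite big_seq [RHS]big_seq; apply: eq_bigr => c cA.
  rewrite fsfunE -/A cA; case: eqP => [->|_].
    by rewrite mul0r big1 // => a _; rewrite big1 // => b _; rewrite hi mulr0.
  by rewrite mulr_suml; apply: eq_bigr => a _; rewrite mulr_suml.
rewrite exchange_big /= big_seq [RHS]big_seq; apply: eq_bigr => a aF.
under eq_bigr do rewrite big_mkcond.
rewrite exchange_big /= mulr_sumr big_seq [RHS]big_seq; apply: eq_bigr => b bG.
have abA : a + b \in A by apply/imfset2P; exists a => //; exists b.
rewrite (big_fsetD1 (a + b)) //= eqxx big_seq big1 ?addr0 ?mulrA // => c.
by rewrite !inE eq_sym => /andP[/negPf -> _].
Qed.

Lemma binalg_lextP F G :
  (forall h, h infty = 0 -> lext h F = lext h G) -> F = G.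
Proof.
move=> e; apply: binalgP => c; have [->|ci] := eqVneq c infty.
  by rewrite !coefsi.
by rewrite !lext_coef // e // eq_sym (negPf ci).
Qed.

Lemma lext_exchange (h : M -> M -> K) F G :
  lext (fun a => lext (h a) G) F = lext (fun b => lext (h^~ b) F) G.
Proof.
rewrite /lext; under eq_bigr do rewrite mulr_sumr.
rewrite exchange_big; apply: eq_bigr => b _; rewrite mulr_sumr.
by apply: eq_bigr => a _; rewrite mulrCA.
Qed.

Lemma lext0 h F : (forall a, h a = 0) -> lext h F = 0.
Proof. by move=> h0; apply: big1 => a _; rewrite h0 mulr0. Qed.

Fact binalg_mulC : commutative binalg_mul.
Proof.
move=> F G; apply: binalg_lextP => h hi; rewrite !lextM // lext_exchange.
by apply: eq_lext => b; apply: eq_lext => a; rewrite addrC.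
Qed.

Fact binalg_mulA : associative binalg_mul.
Proof.
move=> F G H; apply: binalg_lextP => h hi; rewrite lextM // [RHS]lextM //.
rewrite lextM; last by apply: lext0 => b; rewrite iadd hi.
apply: eq_lext => a; rewrite lextM ?addi //.
by apply: eq_lext => b; apply: eq_lext => c; rewrite addrA.
Qed.

Fact binalg_mul1 : left_id (monomial 0) binalg_mul.
Proof.
move=> F; apply: binalg_lextP => h hi; rewrite lextM // lext_monomial.
  by apply: eq_lext => b; rewrite add0r.
by apply: lext0 => b; rewrite iadd hi.
Qed.

Fact binalg_mulDl : left_distributive binalg_mul +%R.
Proof.
by move=> F G H; apply: binalg_lextP => h hi; rewrite lextD !lextM // lextD.
Qed.

HB.instance Definition _ := GRing.Zmodule_isComPzRing.Build binalg
  binalg_mulA binalg_mulC binalg_mul1 binalg_mulDl.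

Fact binalg_scaleA r s F :
  binalg_scale r (binalg_scale s F) = binalg_scale (r * s) F.
Proof. by apply: binalgP => a; rewrite !coefsZ mulrA. Qed.

Fact binalg_scale1 : left_id 1 binalg_scale.
Proof. by move=> F; apply: binalgP => a; rewrite coefsZ mul1r. Qed.

Fact binalg_scaleDr : right_distributive binalg_scale +%R.
Proof.
by move=> r F G; apply: binalgP => a; rewrite coefsZ !coefsD !coefsZ mulrDr.
Qed.

Fact binalg_scaleDl F : {morph binalg_scale^~ F : r s / r + s}.
Proof. by move=> r s; apply: binalgP => a; rewrite coefsD !coefsZ mulrDl. Qed.

HB.instance Definition _ := GRing.Zmodule_isLmodule.Build K binalg
  binalg_scaleA binalg_scale1 binalg_scaleDr binalg_scaleDl.

Lemma binalg_scaleAl (r : K) F G : r *: (F * G) = (r *: F) * G.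
Proof.
by apply: binalg_lextP => h hi; rewrite lextZ !lextM // lextZ.
Qed.

Lemma monomialM a b : monomial a * monomial b = monomial (a + b).
Proof.
by apply: binalg_lextP => h hi; rewrite lextM // !lext_monomial ?addi ?iadd //.
Qed.

Lemma monomial_infty : monomial infty = 0.
Proof.
apply: binalg_lextP => h hi; rewrite lext_monomial // hi.
by rewrite /lext big1 // => a _; rewrite coefs0 mul0r.
Qed.

End BinoidAlgebra.

(** Binoid homomorphisms from [M] to [(K, *, 1, 0)].  This type is empty when
   [0 = infty] in [M]; the empty space is [connected] in the sense of the
   library. *)
Record Kspec (M : binoidType) (K : fieldType) := KPoint {
  Kpoint_fun :> M -> K;
  Kpoint0 : Kpoint_fun 0 = 1;
  KpointD : {morph Kpoint_fun : a b / a + b >-> a * b};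
  Kpointi : Kpoint_fun infty = 0
}.

Definition Kext (M : binoidType) (K : fieldType) (phi : Kspec M K)
  (F : binalg M K) : K := lext phi F.

Section KSpectrum.
Context {M : binoidType} {K : fieldType}.
Implicit Types (phi psi : Kspec M K) (F G : binalg M K).

Lemma Kspec_eqP phi psi : phi =1 psi -> phi = psi.
Proof.
case: phi psi => [f f0 fD fi] [g g0 gD gi] /= /funext fg; subst g.
by congr KPoint; exact: Prop_irrelevance.
Qed.

Lemma KextD phi F G : Kext phi (F + G) = Kext phi F + Kext phi G.
Proof. exact: lextD. Qed.

Lemma KextZ phi r F : Kext phi (r *: F) = r * Kext phi F.
Proof. exact: lextZ. Qed.

Lemma Kext1 phi : Kext phi 1 = 1.
Proof. by rewrite /Kext lext_monomial ?Kpoint0 ?Kpointi. Qed.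

Lemma KextM phi F G : Kext phi (F * G) = Kext phi F * Kext phi G.
Proof.
rewrite /Kext lextM ?Kpointi // /lext mulr_suml; apply: eq_bigr => a _.
rewrite -mulrA; congr (_ * _); rewrite mulr_sumr; apply: eq_bigr => b _.
by rewrite KpointD mulrCA.
Qed.

Lemma Kext_monomial phi a : Kext phi (monomial K a) = phi a.
Proof. by rewrite /Kext lext_monomial ?Kpointi. Qed.

Definition zero_locus (S : set (binalg M K)) : set (Kspec M K) :=
  [set phi | forall F, S F -> Kext phi F = 0].

Definition Kspec_open : set_system (Kspec M K) :=
  [set U | exists S, U = ~` zero_locus S].

Fact Kspec_openT : Kspec_open setT.
Proof.
exists [set 1]; rewrite -setC0; congr (~` _); apply/esym/seteqP; split=> // phi.
by move=> /(_ 1 erefl) /eqP; rewrite Kext1 oner_eq0.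
Qed.

Fact Kspec_openI : setI_closed Kspec_open.
Proof.
move=> _ _ [S ->] [T ->].
exists [set H | exists F G, [/\ S F, T G & H = F * G]].
rewrite -setCU; congr (~` _); apply/seteqP; split=> phi.
  move=> [h|h] _ [F [G [SF TG ->]]]; rewrite KextM.
    by rewrite h ?mul0r.
  by rewrite [X in _ * X]h ?mulr0.
move=> h; apply/or_asboolP/negPn; rewrite negb_or; apply/negP => /andP[].
move=> /asboolP/existsNP[F /not_implyP[SF /eqP F0]].
move=> /asboolP/existsNP[G /not_implyP[TG /eqP G0]].
have /eqP := h (F * G) (ex_intro _ F (ex_intro _ G (And3 SF TG erefl))).
by rewrite KextM mulf_eq0 (negPf F0) (negPf G0).
Qed.

Fact Kspec_open_bigU (I : Type) (f : I -> set (Kspec M K)) :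
  (forall i, Kspec_open (f i)) -> Kspec_open (\bigcup_i f i).
Proof.
move=> /choice[S fS]; exists (\bigcup_i S i); apply/seteqP; split=> phi.
  move=> [i _]; rewrite fS => nz h; apply: nz => F SF.
  by apply: h; exists i.
move=> /existsNP[F /not_implyP[[i _ SF] F0]]; exists i => //.
by rewrite fS => /(_ F SF).
Qed.

HB.instance Definition _ := gen_eqMixin (Kspec M K).
HB.instance Definition _ := gen_choiceMixin (Kspec M K).
HB.instance Definition _ := isOpenTopological.Build (Kspec M K)
  Kspec_openT Kspec_openI Kspec_open_bigU.

Lemma closed_KspecP (Z : set (Kspec M K)) :
  closed Z <-> exists S, Z = zero_locus S.
Proof.
rewrite -openC; split=> -[S e]; exists S; last by rewrite e.
by rewrite -[LHS]setCK e setCK.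
Qed.

End KSpectrum.

Section Pullback.
Context {M N : binoidType} (K : fieldType) (f : binoid_hom M N).
Variable psi : Kspec N K.

Fact pullback0 : (psi \o f) 0 = 1.
Proof. by rewrite /= binoid_hom0 Kpoint0. Qed.

Fact pullbackD : {morph psi \o f : a b / a + b >-> a * b}.
Proof. by move=> a b; rewrite /= binoid_homD KpointD. Qed.

Fact pullbacki : (psi \o f) infty = 0.
Proof. by rewrite /= binoid_homi Kpointi. Qed.

Definition Kspec_pullback : Kspec M K := KPoint pullback0 pullbackD pullbacki.

End Pullback.

Section Parts.
Context {M : binoidType} {K : fieldType}.

Definition cancellative_part_of (P : spec M) : set (Kspec M K) :=
  range (Kspec_pullback (K := K) (can_surjection P)).

Definition cancellative_part (X : set (Kspec M K)) : Prop :=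
  exists P : spec M, X = cancellative_part_of P.

Definition cancellative_component (X : set (Kspec M K)) : Prop :=
  cancellative_part X /\
  (forall Y, cancellative_part Y -> X `<=` Y -> Y = X).

Definition characteristic_point (phi : Kspec M K) : Prop :=
  forall a : M, phi a = 0 \/ phi a = 1.

Lemma characteristic_pointP (phi : Kspec M K) :
  characteristic_point phi <->
  exists P : spec M, forall a : M,
    (P a -> phi a = 0) /\ (~ P a -> phi a = 1).
Proof.
split=> [ch|[P hP] a]; last by have [Pa|Pa] := pselect (P a); have [] := hP a; auto.
suff pr : is_prime [set a | phi a = 0].
  by exists (Spec pr) => a; split=> //= na; case: (ch a).
split.
- by split=> [|a b /= a0]; rewrite /= ?Kpointi // KpointD a0 mul0r.
- move=> e; have : [set a | phi a = 0] 0 by rewrite e.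
  by move=> /eqP; rewrite /= Kpoint0 oner_eq0.
- split=> [/eqP|a b /eqP a0 /eqP b0 /eqP]; first by rewrite Kpoint0 oner_eq0.
  by rewrite KpointD mulf_eq0 (negPf a0) (negPf b0).
Qed.

End Parts.

(* Main.v *)
(* A K-point lies in the cancellative part of P = its kernel, and there are
   finitely many primes, so the components form a finite closed cover; the union
   of the components reachable from a given one is therefore clopen.  A point phi
   of a part may be replaced by the indicator of its nonvanishing set without
   leaving the part.  Finally each part is irreducible: modulo cancellation the
   complement of P embeds in a lattice Z^d, so for F, G not vanishing on the part
   there is a one-parameter family a |-> t^(l a) of points, with the integral
   weight l separating the supports of F and G, along which F and G become nonzero
   Laurent polynomials in t. *)
Require Import Defs.
From mathcomp Require Import all_boot all_order all_algebra finmap.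
From mathcomp Require Import boolp classical_sets cardinality topology.

Local Open Scope classical_set_scope.

Set Implicit Arguments.
Unset Strict Implicit.
Unset Printing Implicit Defensive.

(** * Integral functionals separating rational vectors modulo a subgroup *)

Section LinearAlgebra.
Import Order.TTheory GRing.Theory Num.Theory.
Local Open Scope ring_scope.

Lemma common_denominator (I : finType) (q : I -> rat) :
  exists2 n : nat, (0 < n)%N & exists z : I -> int, forall i, q i *+ n = (z i)%:~R.
Proof.
pose d i : nat := `|denq (q i)|%N.
have dE i : (d i)%:R = (denq (q i))%:~R :> rat.
  by rewrite -[in RHS](gez0_abs (denq_ge0 (q i))).
exists (\prod_i d i)%N; first by rewrite prodn_gt0 // => i; rewrite absz_gt0 denq_neq0.
exists (fun i => numq (q i) *+ \prod_(j | j != i) d j)%N => i.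
rewrite (bigD1 i) //= mulrnA -[q i *+ d i]mulr_natr dE -numqE.
by rewrite -rmorphMn.
Qed.

Lemma poly_nat_nonroot (R : numDomainType) (p : {poly R}) : p != 0 -> exists n : nat, ~~ root p n%:R.
Proof.
move=> p0; apply: contrapT => /forallNP np.
pose rs : seq R := [seq n%:R | n <- iota 0 (size p)].
have rs_roots : all (root p) rs.
  by apply/allP => _ /mapP[n _ ->]; apply: contrapT => /negP; exact: np.
have rs_uniq : uniq rs.
  by rewrite map_inj_uniq ?iota_uniq // => m n /eqP; rewrite eqr_nat => /eqP.
by have := max_poly_roots p0 rs_roots rs_uniq; rewrite size_map size_iota ltnn.
Qed.

Lemma rVpoly_eq0 (R : nzRingType) k (u : 'rV[R]_k) : (rVpoly u == 0) = (u == 0).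
Proof.
apply/eqP/eqP => [u0|->]; last by rewrite linear0.
by rewrite -[u]rVpolyK u0 linear0.
Qed.

Lemma mul_powers_colE (R : comNzRingType) k (u : 'rV[R]_k) t :
  (u *m \col_(j < k) t ^+ j) 0 0 = (rVpoly u).[t].
Proof.
rewrite horner_poly mxE; apply: eq_bigr => j _.
by rewrite mxE valK.
Qed.

(** The rule ['X^i |-> h i] extends to a linear functional on polynomials; here it is applied to the
    zero polynomial. *)
Lemma sum_monomials_eq0 (I : eqType) (K : fieldType) (r : seq I) (c : I -> K) (e : I -> nat) (h : nat -> K) :
  \sum_(a <- r) c a *: 'X^(e a) = 0 -> \sum_(a <- r) c a * h (e a) = 0.
Proof.
move=> p0; pose N := (\max_(a <- r) e a).+1.
transitivity (\sum_(i < N) (\sum_(a <- r) c a *: 'X^(e a))`_i * h i); last first.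
  by rewrite p0; apply: big1 => i _; rewrite coef0 mul0r.
under [RHS]eq_bigr do rewrite coef_sum mulr_suml.
rewrite exchange_big /= big_seq [RHS]big_seq; apply: eq_bigr => a ar.
have aN : (e a < N)%N by rewrite ltnS; exact: leq_bigmax_seq.
rewrite (bigD1 (Ordinal aN)) //= coefZ coefXn eqxx mulr1 big1 ?addr0 // => i ia.
rewrite coefZ coefXn; suff /negPf-> : i != e a :> nat by rewrite mulr0 mul0r.
by apply: contraNneq ia => ia; apply/eqP/val_inj.
Qed.

Section Annihilator.
Context (k : nat) (R : set 'rV[rat]_k).
Hypotheses (R0 : R 0) (RD : forall u v, R u -> R v -> R (u + v)) (RN : forall u, R u -> R (- u)).

Lemma lattice_sumz (I : Type) (r : seq I) (z : I -> int) (v : I -> 'rV[rat]_k) :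
  (forall i, R (v i)) -> R (\sum_(i <- r) v i *~ z i).
Proof.
move=> Rv; have Rn i n : R (v i *+ n).
  by elim: n => [|n ih]; rewrite ?mulr0n // mulrS; apply: RD.
elim/big_rec: _ => // i x _ Rx; apply: RD => //.
by case: (z i) => n; [exact: Rn | apply: RN; exact: Rn].
Qed.

(** [C] is the cokernel of a matrix [A] of maximal rank with rows in [R]. What [C] kills is a
    rational combination of these rows, and clearing denominators lands in [R]. *)
Lemma lattice_annihilator : exists C : 'M[rat]_k,
  (forall w, R w -> w *m C = 0) /\
  (forall w, w *m C = 0 -> exists2 n : nat, (0 < n)%N & R (w *+ n)).
Proof.
pose rk r := `[< exists m (A : 'M[rat]_(m, k)), (forall i, R (row i A)) /\ \rank A = r >].
have ex_rk : exists r, rk r.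
  exists (\rank (0 : 'M[rat]_(0, k))); apply/asboolP; exists 0%N, 0.
  by split=> // -[].
have ub_rk r : rk r -> (r <= k)%N.
  by move=> /asboolP[m [A [_ <-]]]; exact: rank_leq_col.
case: (ex_maxnP ex_rk ub_rk) => r /asboolP[m [A [RA rA]]] maxr.
exists (cokermx A); split=> w.
  move=> Rw; apply/eqP; rewrite -submxE.
  have sA : (A <= col_mx A w)%MS by rewrite (submx_trans (addsmxSl A w)) // addsmxE.
  (* By maximality the extra row [w] cannot raise the rank. *)
  have : (col_mx A w <= A)%MS.
    rewrite -(mxrank_leqif_sup sA) eqn_leq mxrankS //= rA; apply: maxr.
    apply/asboolP; exists (m + 1)%N, (col_mx A w); split=> // i.
    by rewrite -(splitK i); case: (split i) => j; rewrite ?rowKu ?rowKd ?row_id.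
  by rewrite col_mx_sub => /andP[].
move=> /eqP; rewrite -submxE => /submxP[q ->].
have [n n0 [z qz]] := common_denominator (fun i => q 0 i).
exists n => //; rewrite mulmx_sum_row -sumrMnl.
rewrite (eq_bigr (fun i => row i A *~ z i)); first exact: lattice_sumz.
by move=> i _; rewrite scalerMnl qz scaler_int.
Qed.


(** Pairing [w *m C] with the column of powers of [t] evaluates the polynomial [rVpoly (w *m C)] at
    [t], so it suffices that [t] avoids the roots of one nonzero product. *)
Lemma lattice_separating_functional (W : seq 'rV[rat]_k) : exists z : 'I_k -> int,
  (forall w : 'rV[rat]_k, R w -> \sum_i w 0 i * (z i)%:~R = 0) /\
  (forall w, w \in W -> \sum_i w 0 i * (z i)%:~R = 0 ->
    exists2 n : nat, (0 < n)%N & R (w *+ n)).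
Proof.
have [C [RC CR]] := lattice_annihilator.
pose p : {poly rat} := \prod_(w <- W | w *m C != 0) rVpoly (w *m C).
have p0 : p != 0.
  by rewrite prodf_seq_neq0; apply/allP => w _; rewrite rVpoly_eq0; apply/implyP.
have [t pt] := poly_nat_nonroot p0.
pose f := C *m \col_(j < k) (t%:R : rat) ^+ j.
have [n n0 [z fz]] := common_denominator (fun i => f i 0).
have zE (w : 'rV[rat]_k) : \sum_i w 0 i * (z i)%:~R = (rVpoly (w *m C)).[t%:R] *+ n.
  rewrite -mul_powers_colE -mulmxA mxE -sumrMnl; apply: eq_bigr => i _.
  by rewrite -fz mulrnAr.
exists z; split=> w; first by move=> /RC wC; rewrite zE wC linear0 horner0 mul0rn.
move=> wW; rewrite zE => /eqP; rewrite mulrn_eq0 eqn0Ngt n0 /= => wt.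
apply: CR; apply: contraTeq wt => wC; apply: contra pt => /eqP wt.
by rewrite /root horner_prod prodf_seq_eq0; apply/hasP; exists w; rewrite ?wC //= wt.
Qed.

End Annihilator.
End LinearAlgebra.

(** * Weights on the complement of a prime ideal *)

Section PrimeComplement.
Import Order.TTheory GRing.Theory Num.Theory.
Local Open Scope ring_scope.
Context (M : binoidType).
Implicit Types (P : spec M) (a b s : M).

(** For elements outside [P] this is equality in [(M/P)_can], expressed inside [M]. *)
Definition cancel_eq P a b := exists2 s, ~ P s & a + s = b + s.

Lemma prime_ideali P : P infty. Proof. by have [[]] := Defs.primeP P. Qed.

Lemma prime_idealD P a b : P (a + b) <-> P a \/ P b.
Proof.
have [[_ PD] _ [_ nPD]] := Defs.primeP P; split=> [Pab|[/PD//|Pb]].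
  by apply: contrapT => /not_orP[nPa nPb]; exact: (nPD a b nPa nPb).
by rewrite addrC; exact: PD.
Qed.

Lemma prime_ideal0 P : ~ P 0. Proof. by have [_ _ []] := Defs.primeP P. Qed.

Lemma prime_idealMn P a n : ~ P a -> ~ P (a *+ n).
Proof.
move=> Pa; elim: n => [|n ih]; first exact: prime_ideal0.
by rewrite mulrS => /prime_idealD[].
Qed.

Lemma prime_ideal_sum P (I : Type) (r : seq I) (F : I -> M) :
  (forall i, ~ P (F i)) -> ~ P (\sum_(i <- r) F i).
Proof.
by move=> PF; elim/big_rec: _ => [|i a _ Pa /prime_idealD[]//]; [exact: prime_ideal0 | exact: PF].
Qed.

(** The same [s] serves: [(a + s) *+ n] contains [a *+ n + s], hence equals [(b + s) *+ n], and
    torsion-freeness removes [n]. *)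
Lemma cancel_eqMn P a b n : torsion_free M -> (0 < n)%N ->
  cancel_eq P (a *+ n) (b *+ n) -> cancel_eq P a b.
Proof.
move=> tf n0 [s Ps e]; exists s => //; apply: (tf n) => //.
by rewrite !mulrnDl -(prednK n0) (mulrS s) !addrA (prednK n0) e.
Qed.

Section Weight.
Context (P : spec M) (tf : torsion_free M) (k : nat) (x : 'I_k -> M).
Hypotheses (Px : forall i, ~ P (x i))
  (gen : forall a, ~ P a -> exists u : 'I_k -> nat, a = \sum_i x i *+ u i).

Let ev (u : 'I_k -> nat) := \sum_i x i *+ u i.
Let toQ (u : 'I_k -> nat) : 'rV[rat]_k := \row_i (u i)%:R.
(** The kernel of the map from [Z^k] to the difference group of the complement of [P], viewed inside
    [Q^k]. *)
Let rels (w : 'rV[rat]_k) : Prop :=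
  exists u v, w = toQ u - toQ v /\ cancel_eq P (ev u) (ev v).

Let evD u v : ev (fun i => u i + v i)%N = ev u + ev v.
Proof. by rewrite /ev -big_split; apply: eq_bigr => i _; rewrite mulrnDr. Qed.

Let toQD u v : toQ (fun i => u i + v i)%N = toQ u + toQ v.
Proof. by apply/rowP => i; rewrite !mxE natrD. Qed.

Let rels0 : rels 0.
Proof. by exists (fun=> 0%N), (fun=> 0%N); rewrite subrr; split=> //; exists 0 => //; exact: prime_ideal0. Qed.

Let relsN w : rels w -> rels (- w).
Proof. by move=> [u [v [-> [s Ps e]]]]; exists v, u; rewrite opprB; split=> //; exists s. Qed.

Let relsD w w' : rels w -> rels w' -> rels (w + w').
Proof.
move=> [u [v [-> [s Ps e]]]] [u' [v' [-> [s' Ps' e']]]].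
exists (fun i => u i + u' i)%N, (fun i => v i + v' i)%N.
rewrite !toQD !evD opprD addrACA; split=> //.
by exists (s + s'); [move=> /prime_idealD[] | rewrite addrACA e e' addrACA].
Qed.

Lemma separating_weight_gen (A : seq M) : {in A, forall a, ~ P a} ->
  exists l : M -> int,
    (forall a b, ~ P a -> ~ P b -> l (a + b) = l a + l b) /\
    {in A &, forall a b, l a = l b -> cancel_eq P a b}.
Proof.
move=> PA.
have /choice[u uE] a : exists u : 'I_k -> nat, ~ P a -> a = ev u.
  by have [Pa|/gen[v vE]] := pselect (P a); [exists (fun=> 0%N) | exists v].
pose W := [seq toQ (u a) - toQ (u b) | a <- A, b <- A].
have [z [zrel zW]] := lattice_separating_functional rels0 relsD relsN W.
pose l a : int := \sum_i z i *+ u a i.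
have lE a : (l a)%:~R = \sum_i (toQ (u a)) 0 i * (z i)%:~R :> rat.
  by rewrite rmorph_sum; apply: eq_bigr => i _; rewrite mxE rmorphMn /= mulr_natl.
exists l; split=> [a b Pa Pb|a b aA bA].
  (* The chosen exponent vectors need not be additive, but their defect is a relation, which the
     functional kills. *)
  have : rels (toQ (u a) + toQ (u b) - toQ (u (a + b))).
    exists (fun i => u a i + u b i)%N, (u (a + b)); rewrite toQD; split=> //.
    exists 0; [exact: prime_ideal0 | rewrite evD -!uE //].
    by move=> /prime_idealD[].
  move=> /zrel e; apply: (@intr_inj rat); apply/eqP.
  rewrite rmorphD /= !lE -subr_eq0 -oppr_eq0 opprB -[X in _ == X]e -sumrN -!big_split /=.
  by apply/eqP/eq_bigr => i _; rewrite !mxE mulrBl mulrDl.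
move=> lab; have : toQ (u a) - toQ (u b) \in W by apply: allpairs_f.
move=> /zW[].
  transitivity ((l a)%:~R - (l b)%:~R : rat); last by rewrite lab subrr.
  by rewrite !lE -sumrB; apply: eq_bigr => i _; rewrite !mxE mulrBl.
move=> n n0 [v [v' [e [s Ps ve]]]]; apply: (cancel_eqMn tf n0).
(* The relation [n (u a - u b) = v - v'] is evaluated in [M] after moving the negative terms
   across. *)
have nuE : (a *+ n) + ev v' = ev v + b *+ n.
  rewrite [X in X *+ n + _](uE a (PA a aA)) [X in _ = _ + X *+ n](uE b (PA b bA)).
  rewrite /ev -!sumrMnl -!big_split /=.
  apply: eq_bigr => i _; rewrite -!mulrnA -!mulrnDr; congr (_ *+ _).
  apply/eqP; rewrite -(eqr_nat rat) !natrD !natrM !mulr_natr.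
  move/rowP/(_ i): e; rewrite mulrnBl !mxE !mulmxnE !mxE => /eqP.
  by rewrite subr_eq addrAC eq_sym subr_eq eq_sym.
(* Adding [s] allows [ev v] to be exchanged for [ev v'], which is then common to both sides. *)
exists (ev v' + s); first by move=> /prime_idealD[|//]; apply: prime_ideal_sum => i; exact: prime_idealMn.
by rewrite addrA nuE addrAC ve addrAC [RHS]addrA -addrA addrCA addrA.
Qed.

End Weight.

(** The generators of [M] outside [P] generate the complement of [P], since a summand in [P] would
    put the whole sum in [P]. *)
Lemma separating_weight P (A : seq M) : finitely_generated M -> torsion_free M ->
  {in A, forall a, ~ P a} ->
  exists l : M -> int,
    (forall a b, ~ P a -> ~ P b -> l (a + b) = l a + l b) /\
    {in A &, forall a b, l a = l b -> cancel_eq P a b}.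
Proof.
move=> [s sgen] tf; pose g := [seq a <- s | ~~ `[< P a >]].
apply: (@separating_weight_gen P tf (size g) (fun i => nth infty g i)).
  by move=> i; have := mem_nth infty (ltn_ord i); rewrite mem_filter => /andP[/asboolP].
move=> a Pa; have /sgen[t ts aE] : a != infty by apply/eqP => a0; apply: Pa; rewrite a0; exact: prime_ideali.
have tg : {subset t <= g}.
  move=> y yt; rewrite mem_filter ts // andbT; apply/asboolP => Py; apply: Pa.
  by rewrite aE (big_rem y) //=; apply/prime_idealD; left.
elim: t tg {ts Pa} a aE => [|y t ih] tg a ->.
  by exists (fun=> 0%N); rewrite big_nil big1.
have [|u uE] := ih _ _ erefl; first by move=> b bt; apply: tg; rewrite inE bt orbT.
have yg : (index y g < size g)%N by rewrite index_mem tg ?mem_head.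
exists (fun i => (i == Ordinal yg) + u i)%N.
rewrite big_cons uE [RHS](eq_bigr _ (fun i _ => mulrnDr _ _ _)) big_split /=; congr (_ + _).
rewrite (bigD1 (Ordinal yg)) //= eqxx big1 ?addr0 => [|i /negPf->]; last by rewrite mulr0n.
by rewrite nth_index // tg ?mem_head.
Qed.

End PrimeComplement.

(** * Equations and points of cancellative parts *)

Section CancellativeParts.
Import Order.TTheory GRing.Theory Num.Theory.
Local Open Scope ring_scope.
Context (M : binoidType).
Implicit Types (P : spec M) (a b s : M).

(** A witness in [M / P] lifts to an element outside [P]; if both sums fall into [P], primality
    forces [a] and [b] into [P]. *)
Lemma can_surjection_eqP P a b :
  can_surjection P a = can_surjection P b <-> (P a /\ P b) \/ cancel_eq P a b.
Proof.
rewrite /=; split.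
  move=> /bprojP/asboolP[x xi e]; have Ps : ~ P (brepr x).
    by move=> /bproj_rees_infty; rewrite breprK; apply/eqP.
  move: e; rewrite -(breprK x) -!(binoid_homD (bproj_hom (rees_cong P))) /=.
  move=> /bprojP/orP[/eqP e|/andP[/asboolP/prime_idealD Pa /asboolP/prime_idealD Pb]].
    by right; exists (brepr x).
  by left; split; [case: Pa | case: Pb].
case=> [[Pa Pb]|[s Ps e]]; apply/bprojP/asboolP.
  exists 0; first exact: rees_zero_neq_infty.
  by rewrite !addr0; apply: (etrans ((bproj_rees_infty P a).2 Pa)); rewrite (bproj_rees_infty P b).2.
exists (bproj (rees_cong P) s); first by apply/eqP => /bproj_rees_infty.
by rewrite -!(binoid_homD (bproj_hom (rees_cong P))) /= e.
Qed.

Lemma can_surjection_surj P x : exists a, can_surjection P a = x.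
Proof. by exists (brepr (brepr x)); rewrite /= !breprK. Qed.

(** Compose [phi] with any set-theoretic section of [f]: the result is a homomorphism because [phi]
    depends only on the value of [f]. *)
Lemma Kspec_factor (K : fieldType) (N : binoidType) (f : binoid_hom M N) (phi : Kspec M K) :
  (forall y, exists x, f x = y) -> (forall a b, f a = f b -> phi a = phi b) ->
  range (Kspec_pullback (K := K) f) phi.
Proof.
move=> /choice[g gK] fphi.
have psif a : phi (g (f a)) = phi a by apply: fphi; rewrite gK.
have psi0 : phi (g 0) = 1 by rewrite -(binoid_hom0 f) psif Kpoint0.
have psii : phi (g infty) = 0 by rewrite -(binoid_homi f) psif Kpointi.
have psiD : {morph phi \o g : a b / a + b >-> a * b}.
  by move=> y z /=; rewrite -{1}(gK y) -{1}(gK z) -binoid_homD psif KpointD.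
by exists (KPoint psi0 psiD psii) => //; apply: Kspec_eqP.
Qed.

Context (K : fieldType).
Implicit Types phi psi : Kspec M K.

(** Trades the quotients for conditions in [M], the form in which parts are handled below. *)
Lemma cancellative_part_ofP P phi : cancellative_part_of P phi <->
  (forall a, P a -> phi a = 0) /\ (forall a b, cancel_eq P a b -> phi a = phi b).
Proof.
split=> [[psi _ <-]|[phi0 phiE]].
  split=> [a Pa|a b ab]; rewrite /Kspec_pullback /=.
    rewrite -(Kpointi psi) -(binoid_homi (can_surjection P)); congr (psi _).
    by apply/can_surjection_eqP; left; split=> //; exact: prime_ideali.
  by congr (psi _); apply/can_surjection_eqP; right.
apply: Kspec_factor (@can_surjection_surj P) _ => a b /can_surjection_eqP.
by move=> [[Pa Pb]|/phiE//]; rewrite !phi0.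
Qed.

Lemma weight_in_part P (l : M -> int) (t : K) : t != 0 ->
  (forall a b, ~ P a -> ~ P b -> l (a + b) = l a + l b) ->
  exists2 chi : Kspec M K, cancellative_part_of P chi &
    forall a, chi a = if `[< P a >] then 0 else t ^ l a.
Proof.
move=> t0 lD; pose chi a : K := if `[< P a >] then 0 else t ^ l a.
have chi0 : chi 0 = 1.
  have nP0 := @prime_ideal0 M P; rewrite /chi asboolF //.
  (* [l 0 = l 0 + l 0] forces [l 0 = 0]. *)
  by have /eqP := lD _ _ nP0 nP0; rewrite addr0 -subr_eq subrr => /eqP<-.
have chii : chi infty = 0 by rewrite /chi asboolT //; exact: prime_ideali.
have chiD : {morph chi : a b / a + b >-> a * b}.
  move=> a b; rewrite /chi; case: asboolP => [/prime_idealD[]?|Pab].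
  - by rewrite (asboolT (P := P a)) ?mul0r.
  - by rewrite (asboolT (P := P b)) ?mulr0.
  rewrite !asboolF; [|by move=> ?; apply/Pab/prime_idealD; auto..].
  by rewrite lD ?expfzDr //; move=> ?; apply/Pab/prime_idealD; auto.
exists (KPoint chi0 chiD chii) => //; apply/cancellative_part_ofP; split=> /= [a Pa|a b [s Ps e]].
  by rewrite /chi asboolT.
have chis : chi s != 0 by rewrite /chi asboolF // expfz_neq0.
by apply: (mulIf chis); rewrite -!chiD e.
Qed.

Lemma Kext_part P phi F : cancellative_part_of P phi ->
  Kext phi F = \sum_(a <- [seq a <- finsupp (coefs F) | ~~ `[< P a >]]) coefs F a * phi a.
Proof.
move=> /cancellative_part_ofP[phi0 _]; rewrite /Kext /lext big_filter.
rewrite (bigID (fun a => `[< P a >])) /= big1 ?add0r // => a /asboolP Pa.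
by rewrite phi0 ?mulr0.
Qed.

End CancellativeParts.

(** * Irreducibility and connectedness of parts *)

Section Irreducibility.
Import Order.TTheory GRing.Theory Num.Theory.
Local Open Scope ring_scope.
Context (M : binoidType) (K : closedFieldType).
Hypotheses (fg : finitely_generated M) (tf : torsion_free M).

Lemma cancellative_part_irreducible (P : spec M) (phi psi : Kspec M K) F G :
  cancellative_part_of P phi -> cancellative_part_of P psi ->
  Kext phi F != 0 -> Kext psi G != 0 ->
  exists2 chi : Kspec M K, cancellative_part_of P chi & Kext chi F != 0 /\ Kext chi G != 0.
Proof.
move=> Xphi Xpsi F0 G0.
pose S (H : binalg M K) := [seq a <- finsupp (coefs H) | ~~ `[< P a >]].
pose A := S F ++ S G.
have PA : {in A, forall a, ~ P a}.
  by move=> a; rewrite mem_cat !mem_filter -andb_orr => /andP[/asboolP].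
have [l [lD lA]] := separating_weight fg tf PA.
(* Shifting by [m] makes the weights of [A] nonnegative, so the Laurent polynomials become ordinary
   ones. *)
pose m := (\sum_(a <- A) `|l a|)%N.
have lm a : a \in A -> exists n : nat, l a + m%:Z = n%:Z.
  move=> aA; exists `|(l a + m%:Z)%R|%N; rewrite gez0_abs //.
  have lea : (`|l a|%N <= m)%N by rewrite /m (big_rem a) //= leq_addr.
  by rewrite -lerBlDr sub0r lerNl (le_trans (ler_norm _)) // normrN -abszE lez_nat.
pose e a : nat := `|(l a + m%:Z)%R|%N.
have eE a : a \in A -> l a + m%:Z = (e a)%:Z by move=> /lm[n E]; rewrite /e E.
pose p H : {poly K} := \sum_(a <- S H) coefs H a *: 'X^(e a).
have p_neq0 H (rho : Kspec M K) : {subset S H <= A} -> cancellative_part_of P rho ->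
    Kext rho H != 0 -> p H != 0.
  move=> SA Xrho; apply: contraNneq => pH0.
  have /choice[h hE] n : exists y : K, {in A, forall a, e a = n -> rho a = y}.
    have [[a aA ea]|] := pselect (exists2 a, a \in A & e a = n).
      exists (rho a) => b bA eb; have /cancellative_part_ofP[_] := Xrho; apply.
      by apply: lA => //; apply: (addIr m%:Z); rewrite !eE // ea eb.
    by move=> nA; exists 0 => a aA ea; case: nA; exists a.
  apply/eqP; rewrite (Kext_part _ Xrho) -[RHS](sum_monomials_eq0 h pH0).
  rewrite big_seq [RHS]big_seq; apply: eq_bigr => a /SA aA.
  by rewrite (hE (e a) a).
have SFA : {subset S F <= A} by move=> a aF; rewrite mem_cat aF.
have SGA : {subset S G <= A} by move=> a aG; rewrite mem_cat aG orbT.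
(* The factor ['X] excludes [t = 0], making the negative powers of [t] meaningful. *)
have /closed_nonrootP[t] : p F * p G * 'X != 0.
  by rewrite !mulf_neq0 ?polyX_eq0 ?(p_neq0 _ _ SFA Xphi) ?(p_neq0 _ _ SGA Xpsi).
rewrite !rootM !negb_or rootX -andbA => /and3P[tF tG t0].
have [chi Xchi chiE] := weight_in_part t0 lD.
have pt H : {subset S H <= A} -> (p H).[t] = Kext chi H * t ^+ m.
  move=> SA; rewrite (Kext_part _ Xchi) mulr_suml horner_sum.
  rewrite big_seq [RHS]big_seq; apply: eq_bigr => a /SA aA.
  rewrite hornerZ hornerXn chiE asboolF; last exact: PA.
  by rewrite -mulrA -[t ^+ m]/(t ^ m%:Z) -expfzDr // eE.
exists chi => //; move: tF tG; rewrite /root !pt // !mulf_eq0 !negb_or.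
by move=> /andP[-> _] /andP[-> _].
Qed.

(** A proper nonempty clopen subset and its complement would be disjoint nonempty open sets, against
    irreducibility. *)
Lemma cancellative_part_connected (P : spec M) :
  connected (cancellative_part_of P : set (Kspec M K)).
Proof.
move=> B [phi Bphi] [C [S CS] BC] [D /closed_KspecP[T DT] BD].
have [Xphi Cphi] : (cancellative_part_of P `&` C) phi by rewrite -BC.
apply/seteqP; split=> psi; first by rewrite BD => -[].
move=> Xpsi; apply: contrapT => Bpsi.
move: Cphi; rewrite CS => /existsNP[F /not_implyP[SF /eqP F0]].
have : ~ D psi by move=> Dpsi; apply: Bpsi; rewrite BD.
rewrite DT => /existsNP[G /not_implyP[TG /eqP G0]].
have [chi Xchi [chiF chiG]] := cancellative_part_irreducible Xphi Xpsi F0 G0.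
have : B chi by rewrite BC; split=> //; rewrite CS => /(_ F SF)/eqP; apply/negP.
by rewrite BD DT => -[_ /(_ G TG)/eqP]; apply/negP.
Qed.

End Irreducibility.

(** * Closedness, finiteness and maximality of parts *)

Section Components.
Import Order.TTheory GRing.Theory Num.Theory.
Local Open Scope ring_scope.
Context (M : binoidType) (K : fieldType).
Implicit Types (P Q : spec M) (phi psi chi : Kspec M K) (X Y : set (Kspec M K)).

Fact kernel_prime phi : is_prime [set a | phi a = 0].
Proof.
split.
- by split=> [|a b /= a0]; rewrite /= ?Kpointi // KpointD a0 mul0r.
- move=> e; have : [set a | phi a = 0] 0 by rewrite e.
  by move=> /eqP; rewrite /= Kpoint0 oner_eq0.
- split=> [/eqP|a b /eqP a0 /eqP b0 /eqP]; first by rewrite Kpoint0 oner_eq0.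
  by rewrite KpointD mulf_eq0 (negPf a0) (negPf b0).
Qed.

Definition Kpoint_kernel phi : spec M := Spec (kernel_prime phi).

(** Hence the parts cover the spectrum: [phi s] is nonzero for [s] off the kernel and can be
    cancelled in [K]. *)
Lemma mem_kernel_part phi : cancellative_part_of (Kpoint_kernel phi) phi.
Proof.
apply/cancellative_part_ofP; split=> // a b [s /eqP s0 e].
by apply: (mulIf s0); rewrite -!KpointD e.
Qed.

(** The point is [alpha_P], obtained from the zero weight at [t = 1]. *)
Lemma characteristic_point_of P : exists2 chi : Kspec M K, characteristic_point chi &
  cancellative_part_of P chi /\ forall a, chi a = 0 <-> P a.
Proof.
have [||chi Xchi chiE] := @weight_in_part M K P (fun=> 0) 1; rewrite ?oner_neq0 //.
exists chi; first by move=> a; rewrite chiE; case: ifP; auto.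
split=> // a; rewrite chiE; case: asboolP => // nPa; split=> // /eqP.
by rewrite expr0z oner_eq0.
Qed.

(** The equations [phi a = 0] and [phi a = phi b] of a part survive when every nonzero value is
    replaced by [1]. *)
Lemma cancellative_part_characteristic P phi chi : characteristic_point chi ->
  (forall a, chi a = 0 <-> phi a = 0) ->
  cancellative_part_of P phi -> cancellative_part_of P chi.
Proof.
move=> ch chiE /cancellative_part_ofP[phi0 phiE]; apply/cancellative_part_ofP.
split=> [a /phi0 /chiE//|a b /phiE ab].
have e : chi a = 0 <-> chi b = 0 by rewrite !chiE ab.
case: (ch a) => a0; first by rewrite a0; apply/esym/e.
by case: (ch b) => b0; rewrite ?a0 ?b0 //; move: a0; rewrite (e.2 b0).
Qed.

(** The part is cut out by the monomials [T^a] with [a] in [P] and the binomials [T^a - T^b] with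
    [cancel_eq P a b]. *)
Lemma closed_cancellative_part X : cancellative_part X -> closed X.
Proof.
move=> [P ->]; apply/closed_KspecP.
exists [set F | (exists2 a, P a & F = monomial K a) \/
  exists a b, cancel_eq P a b /\ F = monomial K a - monomial K b].
apply/seteqP; split=> phi.
  move=> /cancellative_part_ofP[phi0 phiE] F [[a Pa ->]|[a [b [ab ->]]]].
    by rewrite Kext_monomial phi0.
  by rewrite -scaleN1r KextD KextZ !Kext_monomial (phiE _ _ ab) mulN1r subrr.
move=> phi0; apply/cancellative_part_ofP; split=> [a Pa|a b ab].
  by rewrite -Kext_monomial; apply: phi0; left; exists a.
apply/eqP; rewrite -subr_eq0 -mulN1r -!Kext_monomial -KextZ -KextD scaleN1r.
by apply/eqP; apply: phi0; right; exists a, b.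
Qed.

Hypothesis fg : finitely_generated M.

(** A prime is determined by the generators of [M] it contains, and there are finitely many sets of
    generators. *)
Lemma finite_cancellative_parts : finite_set (@cancellative_part M K).
Proof.
have [s sgen] := fg.
pose gens P : {set 'I_(size s)} := [set i : 'I_(size s) | `[< P (nth infty s i) >]]%SET.
have gensE P Q : gens P = gens Q -> P = Q :> (M -> Prop).
  have half P' Q' : gens P' = gens Q' -> forall a, P' a -> Q' a.
    move=> PQ a; have [->|/sgen[t ts ->]] := eqVneq a infty.
      by move=> _; exact: prime_ideali.
    rewrite big_seq; elim/big_ind: _ => [/prime_ideal0//|x y Px Py|x xt Px].
      by move=> /prime_idealD[/Px|/Py] ?; apply/prime_idealD; auto.
    have xs : (index x s < size s)%N by rewrite index_mem ts.
    have : Ordinal xs \in gens P' by rewrite inE; apply/asboolP; rewrite nth_index ?ts.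
    by rewrite PQ inE => /asboolP; rewrite nth_index ?ts.
  by move=> PQ; apply/funext => a; apply/propext; split; apply: half.
(* The union over all primes with trace [A] makes [part] total; by [gensE] these primes agree as
   predicates. *)
pose part A : set (Kspec M K) :=
  [set phi | exists2 P, gens P = A & cancellative_part_of P phi].
apply: (@sub_finite_set _ _ (range part)); last exact: finite_image.
move=> _ [P ->]; exists (gens P) => //; apply/seteqP; split=> phi; last by exists P.
move=> [Q /gensE QP /cancellative_part_ofP[phi0 phiE]]; apply/cancellative_part_ofP.
by rewrite /cancel_eq -QP.
Qed.

(** Among the parts containing [X], one that contains the most parts is maximal. *)
Lemma sub_cancellative_component X : cancellative_part X ->
  exists2 Y, cancellative_component Y & X `<=` Y.
Proof.
have /finite_seqP[r rE] := finite_cancellative_parts.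
have inr Y : cancellative_part Y <-> Y \in r.
  by rewrite rE.
move=> pX; pose c Y := count (fun Z => `[< Z `<=` Y >]) r.
pose val n := `[< exists Y, [/\ cancellative_part Y, X `<=` Y & c Y = n] >].
have ex : exists n, val n by exists (c X); apply/asboolP; exists X; split.
have ub n : val n -> (n <= size r)%N.
  by move=> /asboolP[Y [_ _ <-]]; exact: count_size.
case: (ex_maxnP ex ub) => n /asboolP[Y [pY XY cY]] max; exists Y => //.
split=> // Z pZ YZ; apply: contrapT => ZY.
have /max : val (c Z) by apply/asboolP; exists Z; split=> //; exact: subset_trans YZ.
apply/negP; rewrite -ltnNge -cY /c.
have ZY' : ~ (Z `<=` Y) by move=> ZsY; apply: ZY; apply/seteqP.
(* [Z] is counted for [Z] but not for [Y], so strict inclusion raises the count. *)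
move: (pZ) => /inr /perm_to_rem /permP E.
rewrite !E /= (asboolF ZY') (asboolT (@subset_refl _ Z)) add0n add1n ltnS.
by apply: sub_count => W /asboolP WY; apply/asboolP; exact: subset_trans YZ.
Qed.

Lemma mem_cancellative_component phi : exists2 X, cancellative_component X & X phi.
Proof.
have [X cX sX] := @sub_cancellative_component _ (ex_intro _ (Kpoint_kernel phi) erefl).
by exists X => //; apply: sX; exact: mem_kernel_part.
Qed.

End Components.

(** * Chains of components and clopen sets *)

Section Chains.
Context (M : binoidType) (K : closedFieldType).
Implicit Types (X Y : set (Kspec M K)) (phi : Kspec M K).

(** Values of [X_] outside the indices [1] to [n] are unconstrained. *)
Definition component_chain X Y :=
  exists (n : nat) (X_ : nat -> set (Kspec M K)),
    [/\ 1 <= n, X_ 1 = X, X_ n = Y,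
        forall i, 1 <= i <= n -> cancellative_component (X_ i) &
        forall i, 1 <= i < n -> exists phi, (X_ i `&` X_ i.+1) phi].

Lemma component_chain_refl X : cancellative_component X -> component_chain X X.
Proof.
by move=> cX; exists 1, (fun=> X); split=> // i /andP[i1]; rewrite ltnNge i1.
Qed.

Lemma component_chain_step X Y Z phi : component_chain X Y -> cancellative_component Z ->
  Y phi -> Z phi -> component_chain X Z.
Proof.
move=> [n [X_ [n1 X1 Xn cX mX]]] cZ Yphi Zphi.
exists n.+1, (fun i => if i <= n then X_ i else Z); split=> //.
- by rewrite n1.
- by rewrite ltnn.
- by move=> i /andP[i1 _]; case: ifP => // iN; apply: cX; rewrite i1.
- move=> i /andP[i1 iN1]; have /orP[/eqP->|iN] : (i == n) || (i < n) by rewrite -leq_eqVlt.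
    by rewrite leqnn ltnn Xn; exists phi.
  by rewrite ltnW ?iN //; apply: mX; rewrite i1.
Qed.

Hypothesis fg : finitely_generated M.

Lemma connected_component_chain : connected [set: Kspec M K] ->
  forall X Y, cancellative_component X -> cancellative_component Y -> component_chain X Y.
Proof.
move=> conn X Y cX cY.
have closedU (D : set (set (Kspec M K))) :
    D `<=` @cancellative_component M K -> closed (\bigcup_(Z in D) Z).
  move=> Dc; apply: closed_bigcup => [|Z /Dc[pZ _]]; last exact: closed_cancellative_part.
  by apply: sub_finite_set (finite_cancellative_parts K fg) => Z /Dc[].
pose D := [set Z | cancellative_component Z /\ component_chain X Z].
pose E := [set Z | cancellative_component Z /\ ~ component_chain X Z].
(* A point common to a reachable and an unreachable component would extend a chain to the latter. *)
have DE : \bigcup_(Z in D) Z = ~` \bigcup_(Z in E) Z.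
  apply/seteqP; split=> phi.
    by move=> [Z [cZ XZ] Zphi] [W [cW nXW] Wphi]; apply: nXW; exact: component_chain_step Zphi Wphi.
  have [Z cZ Zphi] := mem_cancellative_component fg phi => nE.
  by exists Z => //; split=> //; apply: contrapT => nXZ; apply: nE; exists Z.
have component_neq0 (Z : set (Kspec M K)) : cancellative_component Z -> Z !=set0.
  by move=> [[P ->] _]; have [chi _ [? _]] := characteristic_point_of K P; exists chi.
have D_T : \bigcup_(Z in D) Z = setT.
  apply: conn.
  - have [phi Xphi] := component_neq0 _ cX.
    by exists phi, X => //; split=> //; exact: component_chain_refl.
  - exists (~` \bigcup_(Z in E) Z); last by rewrite setTI.
    by rewrite openC; apply: closedU => Z [].
  - exists (\bigcup_(Z in D) Z); last by rewrite setTI.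
    by apply: closedU => Z [].
have [phi Yphi] := component_neq0 _ cY.
(* The reachable [Z] may differ from [Y], but it shares [phi] with [Y], which allows one last
   step. *)
have [Z [_ XZ] Zphi] : (\bigcup_(Z in D) Z) phi by rewrite D_T.
exact: component_chain_step Zphi Yphi.
Qed.

(** Components are connected, so a clopen [B] contains every component it meets, and this propagates
    along a chain. *)
Lemma component_chain_connected : torsion_free M ->
  (forall X Y, cancellative_component X -> cancellative_component Y -> component_chain X Y) ->
  connected [set: Kspec M K].
Proof.
move=> tf chain B [phi Bphi] [C oC BC] [D cD BD].
have {BC}BC : B = C by rewrite BC setTI.
have {BD}BD : B = D by rewrite BD setTI.
apply/seteqP; split=> // psi _.
have meets X : cancellative_component X -> X `&` B !=set0 -> X `<=` B.
  move=> [[P ->] _] XB; apply/setIidPl.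
  by apply: cancellative_part_connected => //; [exists C; rewrite ?BC | exists D; rewrite ?BD].
have [X cX Xphi] := mem_cancellative_component fg phi.
have [Y cY Ypsi] := mem_cancellative_component fg psi.
have [n [X_ [n1 X1 Xn cX_ mX]]] := chain X Y cX cY.
suff XB i : 1 <= i <= n -> X_ i `<=` B by apply: (XB n); rewrite ?n1 ?leqnn ?Xn.
elim: i => // -[_ _|i ih /andP[_ iN]].
  by rewrite X1; apply: meets => //; exists phi.
have [rho [Xi Xi1]] := mX i.+1 iN.
by apply: meets; [exact: cX_ | exists rho; split=> //; apply: ih => //; exact: ltnW].
Qed.

End Chains.

Theorem theorem4p5p2 (M : binoidType) (K : closedFieldType)
    (Mfg : finitely_generated M) (Mtf : torsion_free M) :
  [<-> connected [set: Kspec M K];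
       forall X Y : set (Kspec M K),
         cancellative_component X -> cancellative_component Y ->
         exists (n : nat) (X_ : nat -> set (Kspec M K)),
           [/\ 1 <= n, X_ 1 = X, X_ n = Y,
               forall i, 1 <= i <= n -> cancellative_component (X_ i) &
               forall i, 1 <= i < n ->
                 exists phi : Kspec M K, (X_ i `&` X_ i.+1) phi];
       forall X Y : set (Kspec M K),
         cancellative_component X -> cancellative_component Y ->
         exists (n : nat) (X_ : nat -> set (Kspec M K)),
           [/\ 1 <= n, X_ 1 = X, X_ n = Y,
               forall i, 1 <= i <= n -> cancellative_component (X_ i) &
               forall i, 1 <= i < n ->
                 exists phi : Kspec M K,
                   (X_ i `&` X_ i.+1) phi /\ characteristic_point phi]].
Proof.
tfae.
- exact: connected_component_chain.
- move=> chain X Y cX cY; have [n [X_ [n1 X1 Xn cX_ mX]]] := chain X Y cX cY.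
  exists n, X_; split=> // i iN; have [phi [Xi Xi1]] := mX i iN.
  (* [chi] has the same zeros as [phi], hence lies in every part containing [phi], in particular in
     both neighbours. *)
  have [chi chich [_ chiE]] := characteristic_point_of K (Kpoint_kernel phi).
  have [i0 iN'] := andP iN.
  exists chi; split=> //; split.
    have [[P PE] _] : cancellative_component (X_ i) by apply: cX_; rewrite i0 ltnW.
    by move: Xi; rewrite PE; exact: cancellative_part_characteristic.
  have [[P PE] _] : cancellative_component (X_ i.+1) by exact: cX_.
  by move: Xi1; rewrite PE; exact: cancellative_part_characteristic.
- move=> chain; apply: component_chain_connected => // X Y cX cY.
  have [n [X_ [n1 X1 Xn cX_ mX]]] := chain X Y cX cY.
  by exists n, X_; split=> // i /mX[phi [phiX _]]; exists phi.
Qed.
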